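(* There is a choice $k = \tilde{O}(1/\epsilon)$ such that the following randomized algorithm (the edge-sampling test) is a one-sided tester for odd-cycle-freeness with query complexity $\tilde{O}(1/\epsilon^2)$. Given $\epsilon \in (0,1)$ and oracle access to $f:\mathbb{F}_2^n\to\{0,1\}$: pick $\alpha_1,\ldots,\alpha_k\in\mathbb{F}_2^n$ independently and uniformly at random, let $G=\{\alpha_i-\alpha_j : i<j\}$, query $f$ on all points of $G$, and accept if and only if the restriction of $f$ to $G$ is odd-cycle-free, i.e. there are no odd $m\ge 1$ and $x_1,\ldots,x_m\in G$ with $f(x_1)=\cdots=f(x_m)=1$ and $x_1+\cdots+x_m=0$. That is: every odd-cycle-free $f$ is accepted with probability $1$, and every $f$ that is $\epsilon$-far from odd-cycle-free is rejected with probability at least $2/3$.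
   Context: A function $f:\mathbb{F}_2^n\to\{0,1\}$ is odd-cycle-free (OCF) if for every odd $k\ge 1$ there are no $x_1,\ldots,x_k\in\mathbb{F}_2^n$ with $x_1+\cdots+x_k=0$ and $f(x_i)=1$ for all $i$. The distance between $f,g:\mathbb{F}_2^n\to\{0,1\}$ is $\delta(f,g)=\Pr_x[f(x)\ne g(x)]$ for uniform $x$; the distance of $f$ from OCF is $\min\{\delta(f,g): g \text{ OCF}\}$, and $f$ is $\epsilon$-far from OCF if this distance is at least $\epsilon$. Query complexity is the number of evaluations of $f$. *)

(* Defs.v *)
From HB Require Import structures.
From mathcomp Require Import all_boot all_order all_algebra.
From mathcomp Require Import boolp reals exp.

Set Implicit Arguments.
Unset Strict Implicit.
Unset Printing Implicit Defensive.

Import Order.TTheory GRing.Theory Num.Theory.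
Local Open Scope ring_scope.

Notation F2vec n := 'rV['F_2]_n.
Notation boolfun n := {ffun F2vec n -> bool}.

Definition Pr (R : realType) (T : finType) (E : pred T) : R :=
  #|E|%:R / #|T|%:R.

Definition ocf_on (n : nat) (A : {set F2vec n}) (f : boolfun n) : Prop :=
  forall (m : nat) (x : 'I_m -> F2vec n), odd m ->
    ~ [/\ forall i, x i \in A, forall i, f (x i) = true & \sum_(i < m) x i = 0].

Definition OCF (n : nat) (f : boolfun n) : Prop := ocf_on [set: F2vec n] f.

Definition fdist (R : realType) (n : nat) (f g : boolfun n) : R :=
  Pr R [pred x : F2vec n | f x != g x].

(* The default value 1 never matters: fdist is at most 1 and the zero function
   is odd-cycle-free. *)
Definition dist_OCF (R : realType) (n : nat) (f : boolfun n) : R :=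
  \big[Num.min/1]_(g : boolfun n | `[< OCF g >]) fdist R f g.

Definition eps_far (R : realType) (n : nat) (eps : R) (f : boolfun n) : Prop :=
  eps <= dist_OCF R f.

(* The seed of the test: k independent uniform vectors, i.e. a uniform element
   of this finite type. *)
Notation seed k n := {ffun 'I_k -> F2vec n}.

Definition edge_queries (k n : nat) (alpha : seed k n) : {set F2vec n} :=
  [set alpha p.1 - alpha p.2 | p : 'I_k * 'I_k & (p.1 < p.2)%N].

Definition edge_accepts (k n : nat) (f : boolfun n) (alpha : seed k n) : bool :=
  `[< ocf_on (edge_queries alpha) f >].

(* Worst case over the seed; the queries are non-adaptive and do not depend
   on f. *)
Definition query_complexity (k n : nat) : nat :=
  (\max_(alpha : seed k n) #|edge_queries alpha|)%N.

(* h = O(g * polylog g), uniformly for eps in (0,1), where g >= 1 there.  The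
   1 + keeps the logarithmic factor away from 0 as eps tends to 1. *)
Definition soft_O (R : realType) (h : R -> nat) (g : R -> R) : Prop :=
  exists (C : R) (c : nat), forall eps : R, 0 < eps < 1 ->
    (h eps)%:R <= C * (g eps * (1 + ln (g eps)) ^+ c).

(* Main.v *)
Require Import Defs.
From HB Require Import structures.
From mathcomp Require Import all_boot all_order all_algebra.
From mathcomp Require Import boolp reals sequences exp.
From mathcomp Require Import ring lra.

(* View f as the Cayley graph x ~ y iff f (x - y) = 1, which is regular, of
   density rho say.  A Fourier argument shows that a 2-colouring of this graph
   violates at least as large a fraction of the pairs as the best linear one, so
   that f being eps-far from OCF makes the graph eps-far from bipartite; by
   linear algebra over F_2, an accepting seed is a 2-colourable sample.

   Split the sample into U, of size about log(1/eps)/rho, and a remainder.  With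
   good probability all but eps/4 of the vertices have a neighbour in U, and
   then each of the 2^|U| colourings of U forces a colouring of these vertices,
   with a conflict graph of density at least eps/2.  Since conflict degrees are
   at most rho, conflicts are not concentrated on few vertices, and s further
   samples avoid them all with probability at most exp((1 - s eps / 4) / rho);
   for s = O(log(1/eps)/eps) this beats the union bound over the colourings of
   U.  Regularity is what makes this work with O~(1/eps) vertices. *)

Set Implicit Arguments.
Unset Strict Implicit.
Unset Printing Implicit Defensive.

Import Order.TTheory GRing.Theory Num.Theory.
Local Open Scope ring_scope.

(** * Linear algebra over F_2: odd cycles against linear functionals *)

Section Linear.
Variable n : nat.
Implicit Types (a x y : F2vec n) (f : boolfun n).

Definition dot a x : 'F_2 := (x *m a^T) 0 0.

Lemma F2_cases (z : 'F_2) : z = 0 \/ z = 1.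
Proof.
by case: z => [[|[|//]] i]; [left | right]; apply: val_inj.
Qed.

Lemma natF2 m : (m%:R : 'F_2) = (odd m)%:R.
Proof.
rewrite -[in LHS](odd_double_half m) natrD -muln2 natrM.
by rewrite (_ : 2%:R = 0) ?mulr0 ?addr0 //; apply: val_inj.
Qed.

Lemma dotD a x y : dot a (x + y) = dot a x + dot a y.
Proof. by rewrite /dot mulmxDl mxE. Qed.

Lemma dotDl a b x : dot (a + b) x = dot a x + dot b x.
Proof. by rewrite /dot linearD mulmxDr mxE. Qed.

Lemma dot0 a : dot a 0 = 0.
Proof. by rewrite /dot mul0mx mxE. Qed.

Lemma dot_neq0 x : x != 0 -> exists a, dot a x = 1.
Proof.
move=> /rV0Pn[j xj]; exists (delta_mx 0 j).
rewrite /dot trmx_delta -colE mxE.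
by case: (F2_cases (x 0 j)) => // x0; rewrite x0 eqxx in xj.
Qed.

Lemma rV2_addxx x : x + x = 0.
Proof.
by apply/rowP => j; rewrite !mxE; case: (F2_cases (x 0 j)) => ->;
  apply: val_inj.
Qed.

Lemma rV2_opp x : - x = x.
Proof. by apply/esym/eqP; rewrite -addr_eq0 rV2_addxx. Qed.

(* Farkas' lemma over F_2: a dependency certifying that the system
   [dot a x = 1] is unsolvable is precisely an odd cycle. *)
Lemma ocf_on_functional (A : {set F2vec n}) f : ocf_on A f ->
  exists a, forall x, x \in A -> f x -> dot a x = 1.
Proof.
move=> ocfA; pose B := [set x in A | f x].
pose M : 'M['F_2]_(#|B|, n) := \matrix_(i < #|B|) (enum_val i : F2vec n).
have [/submxP[b Hb]|] := boolP ((const_mx 1 : 'rV['F_2]_#|B|) <= M^T)%MS.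
  exists b => x xA fx; have xB : x \in B by rewrite inE xA fx.
  have := congr1 (fun m : 'rV_#|B| => m 0 (enum_rank_in xB x)) Hb.
  rewrite mxE => ->.
  rewrite -[b *m _]trmxK trmx_mul trmxK mxE /dot !mxE.
  by apply: eq_bigr => j _; rewrite !mxE enum_rankK_in.
(* A cokernel column not killed by the all-one row is the indicator of a set [I] of indices into
   [B]: the vectors it selects sum to 0 and are odd in number. *)
rewrite submxE => /rV0Pn[j]; set K := cokermx _ => Kj.
have MK : M^T *m K = 0 by apply: mulmx_coker.
pose I := [set i | K i j != 0].
have K1 i : K i j = (i \in I)%:R.
  by rewrite inE; case: (F2_cases (K i j)) => ->.
case: (ocfA #|I| (fun i => enum_val (enum_val i))).
  move: Kj; rewrite mxE; under eq_bigr do rewrite mxE mul1r K1.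
  have cI : (\sum_(i < #|B|) (i \in I : nat) = #|I|)%N.
    rewrite -[RHS]sum1_card [RHS]big_mkcond.
    by apply: eq_bigr => i _; case: ifP.
  by rewrite -natr_sum cI natF2; case: odd.
split.
- by move=> i; have := enum_valP (enum_val i); rewrite inE => /andP[].
- by move=> i; have := enum_valP (enum_val i); rewrite inE => /andP[].
rewrite -(big_enum_val (fun i : 'I_#|B| => enum_val i)).
apply/rowP => l; have := congr1 (fun m : 'M_(n, _) => m l j) MK.
rewrite !mxE summxE => {2}<-.
rewrite big_mkcond /=; apply: eq_bigr => i _.
by rewrite K1 !mxE; case: (i \in I); rewrite ?mulr1 ?mulr0.
Qed.

Lemma ocf_of_functional a f : (forall x, f x -> dot a x = 1) -> OCF f.
Proof.
move=> fa m x oddm [_ fx sx].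
have : dot a (\sum_i x i) = m%:R.
  rewrite -[in RHS](card_ord m) -sumr_const.
  rewrite (big_morph _ (dotD a) (dot0 a)).
  by apply: eq_bigr => i _; apply/fa/fx.
by rewrite sx dot0 natF2 oddm.
Qed.

End Linear.

(** * Fourier analysis: from functionals to arbitrary 2-colourings *)

Section Fourier.
Variables (R : realType) (n : nat).
Implicit Types (a x y : F2vec n) (f : boolfun n).
Local Notation N := (#|{: F2vec n}|%:R : R).

Definition chi a x : R := if dot a x == 0 then 1 else -1.

Lemma chiD a x y : chi a (x + y) = chi a x * chi a y.
Proof.
rewrite /chi dotD.
by case: (F2_cases (dot a x)) => ->; case: (F2_cases (dot a y)) => -> /=;
   rewrite ?mulr1 ?mul1r ?mulrNN ?mulr1.
Qed.

Lemma chiDl a b x : chi (a + b) x = chi a x * chi b x.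
Proof.
rewrite /chi dotDl.
by case: (F2_cases (dot a x)) => ->; case: (F2_cases (dot b x)) => -> /=;
   rewrite ?mulr1 ?mul1r ?mulrNN ?mulr1.
Qed.

(** Orthogonality of characters: for [x != 0], translating [a] by some [b] with [dot b x = 1]
    reverses the sign of the sum. *)
Lemma sum_chi x : \sum_a chi a x = (x == 0)%:R * N.
Proof.
have [->|/dot_neq0[b xb]] := eqVneq x 0.
  rewrite mul1r -sumr_const; apply: eq_bigr => a _.
  by rewrite /chi dot0 eqxx.
have : \sum_a chi a x = - \sum_a chi a x.
  rewrite {1}(reindex_inj (addrI b)) -sumrN; apply: eq_bigr => a _.
  by rewrite chiDl {1}/chi xb /= mulN1r.
by rewrite mul0r; lra.
Qed.

(** The squared Fourier coefficients transform back to the autocorrelation: once the square is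
    expanded, orthogonality keeps only [z = y + x]. Parseval is the case [x = 0]. *)
Lemma sum_chi_sqr_corr (s : F2vec n -> R) x :
  \sum_a chi a x * (\sum_y s y * chi a y) ^+ 2 =
  N * \sum_y s y * s (y + x).
Proof.
transitivity (\sum_y \sum_z s y * s z * \sum_a chi a (x + y + z)).
  under [in RHS]eq_bigr do under eq_bigr do rewrite mulr_sumr.
  under [in RHS]eq_bigr do rewrite exchange_big.
  rewrite /= [in RHS]exchange_big; apply: eq_bigr => a _ /=.
  rewrite expr2 mulr_suml mulr_sumr; apply: eq_bigr => y _.
  rewrite !mulr_sumr; apply: eq_bigr => z _.
  by rewrite !chiD; ring.
rewrite mulr_sumr; apply: eq_bigr => y _.
under eq_bigr do rewrite sum_chi.
rewrite (bigD1 (y + x)) //= big1 => [|z zyx].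
  by rewrite (addrC y) rV2_addxx eqxx /= mul1r; ring.
by rewrite addr_eq0 rV2_opp eq_sym addrC (negbTE zyx) mul0r mulr0.
Qed.

(* Distance from bipartiteness of the Cayley graph equals distance from OCF:
   average the hypothesis over [a] with the Fourier weights of the
   colouring. *)
Lemma cayley_violating_pairs (eps : R) f (s : F2vec n -> bool) :
  (forall a, eps * N <= \sum_x (f x && (dot a x == 0))%:R) ->
  eps * N ^+ 2 <= \sum_x \sum_y (f (x - y) && (s x == s y))%:R.
Proof.
move=> far; pose sg y : R := (-1) ^+ s y.
have sg2 y : sg y * sg y = 1 by rewrite /sg -expr2 sqrr_sign.
pose T a := (\sum_y sg y * chi a y) ^+ 2.
have sumT : \sum_a T a = N * N.
  have := sum_chi_sqr_corr sg 0.
  under eq_bigr do rewrite /chi dot0 eqxx mul1r.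
  move=> ->; congr (_ * _); rewrite -sumr_const; apply: eq_bigr => y _.
  by rewrite addr0 sg2.
have N0 : 0 < N by rewrite ltr0n; apply/card_gt0P; exists 0.
have step : \sum_a T a * (eps * N) <=
            \sum_a T a * \sum_x (f x && (dot a x == 0))%:R.
  by apply: ler_sum => a _; rewrite ler_wpM2l // /T sqr_ge0.
suff E : \sum_a T a * \sum_x (f x && (dot a x == 0))%:R =
         N * \sum_x \sum_y (f (x - y) && (s x == s y))%:R.
  rewrite -(ler_pM2l N0) -E; apply: le_trans step.
  by rewrite -mulr_suml sumT; lra.
transitivity (\sum_x (f x)%:R * (N * \sum_y (s y == s (y + x))%:R)).
  under eq_bigr do rewrite mulr_sumr.
  rewrite exchange_big /=; apply: eq_bigr => x _.
  (* The indicator of [dot a x = 0] is [(1 + chi a x) / 2]; after summation against [T] it becomes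
     [(1 + sg y * sg (y + x)) / 2], the indicator of [s y = s (y + x)]. *)
  transitivity ((f x)%:R * \sum_a ((1 + chi a x) / 2 * T a)).
    rewrite mulr_sumr; apply: eq_bigr => a _.
    rewrite /chi; case: (f x); case: eqP => _ /=; lra.
  congr (_ * _).
  transitivity (2^-1 * (\sum_a T a + \sum_a chi a x * T a)).
    rewrite -big_split mulr_sumr; apply: eq_bigr => a _ /=; lra.
  rewrite sumT sum_chi_sqr_corr -mulrDr mulrCA; congr (_ * _).
  rewrite -sumr_const -big_split mulr_sumr; apply: eq_bigr => y _ /=.
  by rewrite /sg; case: (s y); case: (s _); rewrite /= ?expr0 ?expr1; lra.
rewrite [in RHS]exchange_big /=.
under [in RHS]eq_bigr => y _ do rewrite (reindex_inj (addIr y)) /=.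
rewrite [in RHS]exchange_big mulr_sumr; apply: eq_bigr => x _.
rewrite mulrCA; congr (_ * _); rewrite mulr_sumr; apply: eq_bigr => y _.
by rewrite addrK (addrC x) eq_sym -natrM mulnb.
Qed.

(** Erasing from [f] the points with [dot a x = 0] leaves an odd-cycle-free function, and the sum
    counts the erased points. *)
Lemma eps_far_functional (eps : R) f a : eps_far eps f ->
  eps * N <= \sum_x (f x && (dot a x == 0))%:R.
Proof.
move=> far; have N0 : 0 < N by rewrite ltr0n; apply/card_gt0P; exists 0.
pose g : boolfun n := [ffun x => f x && (dot a x != 0)].
have ocfg : OCF g.
  apply: (@ocf_of_functional _ a) => x; rewrite ffunE => /andP[_].
  by case: (F2_cases (dot a x)) => ->; rewrite ?eqxx.
rewrite -ler_pdivlMr //; apply: (le_trans far).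
apply: (@le_trans _ _ (fdist R f g)).
  by apply: bigmin_le_cond; apply/asboolP.
rewrite /fdist /Pr ler_pM2r ?invr_gt0 // -sum1_card natr_sum big_mkcond /=.
apply: ler_sum => x _; rewrite unfold_in /= ffunE.
by case: (f x); case: (dot a x == 0); rewrite /= ?lexx ?ler01.
Qed.

End Fourier.

(** * Elementary exponential inequalities *)

Lemma expRN_le (R : realType) (y : R) : 0 <= y <= 1 -> expR (- y) <= 1 - y / 2.
Proof.
move=> /andP[y0 y1]; rewrite expRN -div1r ler_pdivrMr ?expR_gt0 //.
have h := expR_ge1Dx y.
apply: (@le_trans _ _ ((1 - y / 2) * (1 + y))); first by nra.
by apply: ler_wpM2l => //; lra.
Qed.

Lemma expr1B_le_expR (R : realType) (c : R) m : c <= 1 ->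
  (1 - c) ^+ m <= expR (- (m%:R * c)).
Proof.
move=> c1; rewrite -mulrN expRM_natl lerXn2r ?nnegrE ?expR_ge0 //.
  by rewrite subr_ge0.
by apply: expR_ge1Dx.
Qed.

(** * Sequential sampling, and the probability of meeting no edge *)

Section Sampling.
Variables (R : realType) (V : finType).
Hypothesis V_gt0 : (0 < #|V|)%N.
Local Notation N := (#|V|%:R : R).

Let N_gt0 : 0 < N. Proof. by rewrite ltr0n. Qed.

(** Expectation over [k] independent uniform draws, one at a time so that inductions can condition
    on the first draw; [avg_ffun] recovers the uniform average over seeds. *)
Fixpoint avg k (F : seq V -> R) : R :=
  if k is k'.+1 then N^-1 * \sum_v avg k' (fun l => F (v :: l)) else F [::].

Lemma avg_le k F G : (forall l, size l = k -> F l <= G l) ->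
  avg k F <= avg k G.
Proof.
elim: k F G => [|k IH] F G FG /=; first exact: FG.
rewrite ler_pM2l ?invr_gt0 //; apply: ler_sum => v _.
by apply: IH => l sl; apply: FG; rewrite /= sl.
Qed.

Lemma avg_const k c : avg k (fun=> c) = c.
Proof.
elim: k => //= k ->; rewrite sumr_const -[c *+ _]mulr_natl mulrA.
by rewrite mulVf ?mul1r // gt_eqF.
Qed.

Lemma avg_sum (I : finType) k (F : I -> seq V -> R) :
  avg k (fun l => \sum_i F i l) = \sum_i avg k (F i).
Proof.
elim: k F => [//|k IH] F /=.
rewrite -mulr_sumr exchange_big; congr (_ * _).
by apply: eq_bigr => v _; rewrite IH.
Qed.

Lemma avgD k F G : avg k (fun l => F l + G l) = avg k F + avg k G.
Proof.
elim: k F G => [//|k IH] F G /=.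
by rewrite -mulrDr -big_split; under eq_bigr do rewrite IH.
Qed.

Lemma avgMl k c F : avg k (fun l => c * F l) = c * avg k F.
Proof.
elim: k F => [//|k IH] F /=.
by under eq_bigr do rewrite IH; rewrite -mulr_sumr mulrCA.
Qed.

Lemma avg_cat k m F :
  avg (k + m) F = avg k (fun l => avg m (fun l' => F (l ++ l'))).
Proof. by elim: k F => //= k IH F; under eq_bigr do rewrite IH. Qed.

Lemma avg_ffun k F :
  avg k F = (\sum_(alpha : {ffun 'I_k -> V}) F (codom alpha)) / N ^+ k.
Proof.
elim: k F => [|k IH] F /=.
  rewrite expr0 divr1 (eq_bigl (pred1 [ffun i : 'I_0 => ffun0 (card_ord 0) i])).
    rewrite big_pred1_eq /codom /image_mem (_ : enum _ = [::]) //.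
    by apply/nilP; rewrite /nilp -cardE card_ord.
  by move=> a; apply/esym/eqP/ffunP; case.
under eq_bigr do rewrite IH.
rewrite -mulr_suml exprS invfM mulrCA; congr (_ * _); rewrite pair_big /=.
pose h (p : V * {ffun 'I_k -> V}) : {ffun 'I_k.+1 -> V} :=
  [ffun i => if unlift ord0 i is Some j then p.2 j else p.1].
pose g (a : {ffun 'I_k.+1 -> V}) : V * {ffun 'I_k -> V} :=
  (a ord0, [ffun j => a (lift ord0 j)]).
rewrite [RHS](reindex h) /=; last first.
  exists g => [[v a] _|a _].
    rewrite /g /h /=; congr (_, _); first by rewrite ffunE unlift_none.
    by apply/ffunP => j; rewrite !ffunE liftK.
  apply/ffunP => i; rewrite ffunE /g /=.
  by case: unliftP => [j|] ->; rewrite ?ffunE.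
apply: eq_bigr => [[v a] _]; congr (F _).
rewrite /codom /image_mem enum_ordSl /= ffunE unlift_none -map_comp.
by congr (_ :: _); apply: eq_map => j; rewrite /= ffunE liftK.
Qed.

Lemma Pr_avg k (E : pred {ffun 'I_k -> V}) (B : pred (seq V)) :
  (forall alpha, E alpha -> B (codom alpha)) ->
  Pr R E <= avg k (fun l => (B l)%:R).
Proof.
move=> EB; rewrite avg_ffun /Pr card_ffun card_ord natrX.
rewrite ler_pM2r ?invr_gt0 ?exprn_gt0 // -sum1_card natr_sum big_mkcond /=.
apply: ler_sum => a _; case: ifP => [/EB -> //|_].
by rewrite ler0n.
Qed.

(* The potential [exp ((#|V| - #|W|) / d)], where [W] is the [H]-neighbourhood
   of the vertices drawn so far: the next vertex either falls in [W] or enlarges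
   [W], and the two effects add up to the same factor whatever [#|W|] is. *)
Lemma avg_no_edge (H : rel V) (d : nat) (eta : R) s (W : {set V}) :
  symmetric H -> (0 < d)%N -> (forall v, #|H v| <= d)%N ->
  0 <= eta -> eta * N <= 2 * d%:R ->
  eta * N ^+ 2 <= \sum_v \sum_w (H v w)%:R ->
  avg s (fun l => (all [pred v | v \notin W] l
                   && pairwise [rel v w | ~~ H v w] l)%:R)
  <= expR ((N - #|W|%:R) / d%:R) * (1 - eta * N / (2 * d%:R)) ^+ s.
Proof.
move=> symH d_gt0 degH eta0 etad edgesH.
have d0 : 0 < d%:R :> R by rewrite ltr0n.
set kap := eta * N / (2 * d%:R).
have kap1 : 0 <= 1 - kap by rewrite subr_ge0 ler_pdivrMr ?mul1r //; lra.
elim: s W => [|s IH] W /=.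
  rewrite expr0 mulr1 -[1%:R]expR0 ler_expR divr_ge0 ?ler0n //.
  by rewrite subr_ge0 ler_nat max_card.
pose j v := #|[set w | H v w] :\: W|.
have jd v : (j v <= d)%N.
  apply: leq_trans (degH v); rewrite /j; apply: subset_leq_card.
  by apply/subsetP => w; rewrite !inE => /andP[_].
(* A draw in [W] kills the event. Any other draw adds [j v] vertices to [W], which multiplies the
   potential by exp (- j v / d), at most 1 - j v / (2 d) because [j v <= d]. *)
have step v : avg s (fun l => ((v \notin W) && all [pred v | v \notin W] l &&
      (all (fun w => ~~ H v w) l && pairwise [rel v w | ~~ H v w] l))%:R)
    <= (v \notin W)%:R * (1 - (j v)%:R / d%:R / 2) *
       (expR ((N - #|W|%:R) / d%:R) * (1 - kap) ^+ s).
  have [vW|vW] := boolP (v \in W).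
    by rewrite /= !mul0r avg_const.
  rewrite /= mul1r.
  apply: (@le_trans _ _ (expR ((N - #|W :|: [set w | H v w]|%:R) / d%:R)
                         * (1 - kap) ^+ s)).
    apply: le_trans (IH _); apply: avg_le => l _; rewrite ler_nat.
    case: andP => // [[lW /andP[lH lp]]]; rewrite lp andbT.
    have -> // : all [pred v0 | v0 \notin W :|: [set w | H v w]] l.
    apply/allP => w wl; rewrite /= !inE negb_or.
    by apply/andP; split; [apply: (allP lW) | apply: (allP lH)].
  rewrite mulrA ler_wpM2r ?exprn_ge0 //.
  have -> : #|W :|: [set w | H v w]|%:R = #|W|%:R + (j v)%:R :> R.
    rewrite -natrD -(cardsID W) setDUl setDv set0U.
    by rewrite (setIidPr (subsetUl _ _)).
  rewrite opprD addrA mulrBl expRD mulrC ler_wpM2r ?expR_ge0 //.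
  apply: expRN_le; rewrite divr_ge0 ?ler0n //= ler_pdivrMr // mul1r.
  by rewrite ler_nat.
apply: (@le_trans _ _ (N^-1 * \sum_v (v \notin W)%:R *
    (1 - (j v)%:R / d%:R / 2) *
    (expR ((N - #|W|%:R) / d%:R) * (1 - kap) ^+ s))).
  by rewrite ler_pM2l ?invr_gt0 //; apply: ler_sum => v _; apply: step.
rewrite -mulr_suml exprS [leRHS]mulrCA [leLHS]mulrA ler_wpM2r //.
  by rewrite mulr_ge0 ?expR_ge0 ?exprn_ge0.
rewrite mulrC ler_pdivrMr //.
have WE : \sum_v (v \in W)%:R = #|W|%:R :> R.
  rewrite -sum1_card natr_sum [RHS]big_mkcond.
  by apply: eq_bigr => v _; case: ifP.
have degR v : \sum_w (H v w)%:R <= d%:R :> R.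
  apply: le_trans (_ : #|H v|%:R <= _); last by rewrite ler_nat.
  rewrite -sum1_card natr_sum [X in _ <= X]big_mkcond.
  by apply: ler_sum => w _; case: ifP => //; rewrite unfold_in => ->.
(* An ordered edge either has both ends outside [W], and is counted by some [j v], or has an end in
   [W]; at most [2 * d * #|W|] edges do the latter. *)
have Hle : \sum_v \sum_w (H v w)%:R <=
    \sum_v (v \notin W)%:R * (j v)%:R + 2 * d%:R * #|W|%:R :> R.
  apply: (@le_trans _ _ (\sum_v ((v \notin W)%:R * (j v)%:R
      + (v \in W)%:R * d%:R + \sum_w (w \in W)%:R * (H w v)%:R))).
    apply: ler_sum => v _; case: (v \in W) => /=.
      rewrite !mul1r mul0r add0r; apply: ler_wpDr; last exact: degR.
      by apply: sumr_ge0 => w _; rewrite mulr_ge0 ?ler0n.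
    rewrite mul1r mul0r addr0 /j -sum1_card natr_sum [X in X + _]big_mkcond.
    rewrite -big_split; apply: ler_sum => w _ /=; rewrite !inE symH.
    by case: (w \in W); case: (H _ _); rewrite /= ?mul1r ?mul0r ?addr0 ?add0r.
  rewrite !big_split /= -mulr_suml WE exchange_big /= -addrA lerD2l.
  suff : \sum_w \sum_v (w \in W)%:R * (H w v)%:R <= d%:R * #|W|%:R :> R by lra.
  rewrite -WE mulr_sumr; apply: ler_sum => w _; rewrite -mulr_sumr mulrC.
  by rewrite ler_wpM2r ?ler0n // degR.
have -> : \sum_v (v \notin W)%:R * (1 - (j v)%:R / d%:R / 2) =
    N - #|W|%:R - (\sum_v (v \notin W)%:R * (j v)%:R) / (2 * d%:R).
  rewrite -WE -sumr_const mulr_suml -!sumrB; apply: eq_bigr => v _.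
  by case: (v \in W) => /=; field; rewrite gt_eqF.
have -> : (1 - kap) * N = N - eta * N ^+ 2 / (2 * d%:R).
  by rewrite /kap; field; rewrite gt_eqF.
have d20 : 0 < 2 * d%:R :> R by lra.
(* Dividing [Hle] by [2 * d] gives [#|W|] the same coefficient 1 as the loss from draws in [W], so
   the decrement is independent of [#|W|]. *)
suff : eta * N ^+ 2 / (2 * d%:R) <=
   #|W|%:R + (\sum_v (v \notin W)%:R * (j v)%:R) / (2 * d%:R) by lra.
rewrite ler_pdivrMr // mulrDl divfK ?gt_eqF //.
by lra.
Qed.

End Sampling.

(** * Random samples of a regular graph far from bipartite *)

Section Bipartite.
Variables (R : realType) (V : finType) (e : rel V) (d : nat) (eps : R).
Hypothesis V_gt0 : (0 < #|V|)%N.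
Hypothesis sym_e : symmetric e.
Hypothesis deg_e : forall v, #|e v| = d.
Hypothesis eps_gt0 : 0 < eps.
Local Notation N := (#|V|%:R : R).
Hypothesis far_e : forall s : V -> bool,
  eps * N ^+ 2 <= \sum_v \sum_w (e v w && (s v == s w))%:R.

Let N_gt0 : 0 < N. Proof. by rewrite ltr0n. Qed.

Lemma sum_degree v : \sum_w (e v w)%:R = d%:R :> R.
Proof.
rewrite -(deg_e v) -sum1_card natr_sum [RHS]big_mkcond.
by apply: eq_bigr => w _; rewrite unfold_in; case: ifP.
Qed.

(** Every edge violates a constant colouring, so [far_e] bounds the edge density from below. *)
Lemma eps_le_degree : eps * N <= d%:R.
Proof.
rewrite -(ler_pM2r N_gt0) -mulrA -expr2 (le_trans (far_e xpredT)) //.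
under eq_bigr => v _.
  by under eq_bigr do rewrite eqxx andbT; rewrite sum_degree; over.
by rewrite sumr_const -[_ *+ _]mulr_natr.
Qed.

Let d_gt0 : (0 < d)%N.
Proof.
rewrite -(ltr0n R) (lt_le_trans _ eps_le_degree) //.
by rewrite mulr_gt0.
Qed.

Lemma degree_le : d%:R <= N.
Proof.
by have /card_gt0P[v _] := V_gt0; rewrite -(deg_e v) ler_nat max_card.
Qed.

(** Colours belong to vertices, not to positions: a repeated vertex with a loop cannot be coloured,
    matching the query at 0 made by a repeated seed vector. *)
Definition two_colorable (l : seq V) : bool :=
  `[< exists c : V -> bool, pairwise [rel v w | e v w ==> (c v != c w)] l >].

Definition uncovered (U : seq V) : R := \sum_v (~~ has (e v) U)%:R.

(** Linearity of expectation: each draw misses the [d] neighbours of a fixed vertex with probability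
    [1 - d / N]. *)
Lemma avg_uncovered t : avg t uncovered = N * (1 - d%:R / N) ^+ t.
Proof.
rewrite avg_sum; set p := (_ ^+ t); rewrite -sumr_const mulr_suml /p {p}.
apply: eq_bigr => v _; rewrite mul1r; elim: t => [|t IH] //=.
under eq_bigr => w _.
  rewrite (_ : avg t _ = (1 - (e v w)%:R) * (1 - d%:R / N) ^+ t); last first.
    case: (e v w) => /=; first by rewrite (avg_const V_gt0) subrr mul0r.
    by rewrite IH subr0 mul1r.
  over.
rewrite -mulr_suml sumrB sum_degree sumr_const mulrA exprS; congr (_ * _).
by rewrite mulrBr mulVf ?gt_eqF // mulrC.
Qed.

(* The side of [v] forced by its first neighbour in [U], where [b] lists the
   colours of [U]. *)
Definition forced (U : seq V) (b : seq bool) (v : V) : bool :=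
  ~~ nth false b (find (e v) U).

Definition conflict (U : seq V) (b : seq bool) : rel V := fun v w =>
  [&& e v w, has (e v) U, has (e w) U & forced U b v == forced U b w].

Lemma conflict_sym U b : symmetric (conflict U b).
Proof.
by move=> v w; rewrite /conflict sym_e eq_sym; congr (_ && _); rewrite andbCA.
Qed.

(** Of the pairs violating [forced U b], at most [d * uncovered U] have an uncovered first end, and
    as many an uncovered second end; together this is at most half of what [far_e] provides. *)
Lemma many_conflicts U b : uncovered U <= eps * N / 4 ->
  eps / 2 * N ^+ 2 <= \sum_v \sum_w (conflict U b v w)%:R.
Proof.
move=> covU.
have dU : d%:R * uncovered U <= eps * N ^+ 2 / 4.
  apply: (@le_trans _ _ (N * (eps * N / 4))); last by lra.
  rewrite ler_pM ?ler0n ?degree_le //.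
  by apply: sumr_ge0 => v _; rewrite ler0n.
have dUE : \sum_v \sum_w (~~ has (e v) U)%:R * (e v w)%:R = d%:R * uncovered U.
  rewrite mulr_sumr; apply: eq_bigr => v _.
  by rewrite -mulr_sumr sum_degree mulrC.
suff : \sum_v \sum_w (e v w && (forced U b v == forced U b w))%:R <=
       \sum_v \sum_w (conflict U b v w)%:R + d%:R * uncovered U
         + d%:R * uncovered U by have := far_e (forced U b); lra.
rewrite -{2}dUE -dUE exchange_big -addrA [X in _ + (X + _)]exchange_big addrA.
rewrite [X in _ <= X + _ + _]exchange_big -!big_split /=.
apply: ler_sum => v _; rewrite -!big_split /=; apply: ler_sum => w _.
rewrite /conflict (sym_e w v) -!natrM -!natrD ler_nat.
by case: (e v w); case: (has (e v) U); case: (has (e w) U); case: (_ == _).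
Qed.

(** Take for [b] the values on [U] of a valid colouring. Covered vertices of [l] then have their
    forced colour, so a conflict within [l] would be a violated edge. *)
Lemma two_colorable_cat U l : two_colorable (U ++ l) ->
  exists b : (size U).-tuple bool, pairwise [rel v w | ~~ conflict U b v w] l.
Proof.
move=> /asboolP[c]; rewrite pairwise_cat => /and3P[/allrelP Ul _ lP].
have cE v : v \in l -> has (e v) U -> forced U (map c U) v = c v.
  move=> vl hv; rewrite /forced (nth_map v) -?has_find //.
  have := Ul _ _ (mem_nth v (_ : (find (e v) U < size U)%N)) vl.
  rewrite -has_find => /(_ hv) /=.
  rewrite sym_e (nth_find v hv) /=.
  by case: (c v); case: (c _).
exists (map_tuple c (in_tuple U)).
apply: (sub_in_pairwise (P := [in l])) lP => [v w vl wl /=|]; last exact/allP.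
apply: contraTN => /and4P[evw hv hw]; rewrite !cE // => /eqP ->.
by rewrite evw eqxx.
Qed.

(** The first term is Markov's inequality for [uncovered] at the threshold [eps * N / 4]. The second
    is a union bound over the colourings of [U], with [avg_no_edge] applied to each conflict graph
    from an empty [W]. *)
Lemma avg_two_colorable t s :
  avg (t + s) (fun l => (two_colorable l)%:R) <=
    4 / eps * (1 - d%:R / N) ^+ t +
    2 ^+ t * (expR (N / d%:R) * (1 - eps * N / (4 * d%:R)) ^+ s).
Proof.
rewrite avg_cat.
set B := (X in _ + _ * X).
have d0 : 0 < d%:R :> R by rewrite ltr0n.
have B0 : 0 <= B.
  rewrite mulr_ge0 ?expR_ge0 ?exprn_ge0 // subr_ge0 ler_pdivrMr ?mul1r.
    by have := eps_le_degree; lra.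
  by lra.
apply: (@le_trans _ _
    (avg t (fun U => 4 / (eps * N) * uncovered U + 2 ^+ t * B))); last first.
  rewrite (avgD t) (avgMl t _ uncovered) avg_uncovered (avg_const V_gt0) lerD2r.
  rewrite le_eqVlt; apply/orP; left; apply/eqP; field.
  by rewrite !gt_eqF.
apply: avg_le => // U sU.
have u0 : 0 <= uncovered U by apply: sumr_ge0 => v _; rewrite ler0n.
have tB0 : 0 <= 2 ^+ t * B by rewrite mulr_ge0 ?exprn_ge0.
have [covU|ncovU] := leP (uncovered U) (eps * N / 4); last first.
  apply: (@le_trans _ _ 1).
    rewrite -[X in _ <= X](avg_const V_gt0 s); apply: avg_le => // l _.
    by case: two_colorable.
  apply: ler_wpDr => //; rewrite mulrAC ler_pdivlMr ?mulr_gt0 // mul1r.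
  by lra.
apply: ler_wpDl; first by rewrite mulr_ge0 // divr_ge0 ?ler0n ?ltW ?mulr_gt0.
apply: (@le_trans _ _ (avg s (fun l => \sum_(b : t.-tuple bool)
   (pairwise [rel v w | ~~ conflict U b v w] l)%:R))).
  apply: avg_le => // l _; case: (boolP (two_colorable _)) => [|_]; last first.
    by apply: sumr_ge0 => b _; rewrite ler0n.
  move=> /two_colorable_cat; rewrite sU => -[b bP].
  rewrite (bigD1 b) //= bP ler_wpDr //.
  by apply: sumr_ge0 => b' _; rewrite ler0n.
rewrite avg_sum.
apply: (@le_trans _ _ (\sum_(b : t.-tuple bool) B)); last first.
  by rewrite sumr_const card_tuple card_bool -[_ *+ _]mulr_natl natrX.
apply: ler_sum => b _.
have -> : B = expR ((N - #|@set0 V|%:R) / d%:R) *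
              (1 - eps / 2 * N / (2 * d%:R)) ^+ s.
  rewrite cards0 subr0; congr (_ * (1 - _) ^+ s); field.
  by rewrite gt_eqF.
apply: le_trans (_ : _ <= avg s (fun l => (all [pred v | v \notin set0] l
  && pairwise [rel v w | ~~ conflict U b v w] l)%:R)) _.
  apply: avg_le => // l _; rewrite ler_nat (_ : all _ l = true) //.
  by apply/allP => v _; rewrite /= inE.
apply: (@avg_no_edge _ _ V_gt0 _ _ _ _ _ (conflict_sym U b) d_gt0).
- move=> v; rewrite -(deg_e v); apply: subset_leq_card.
  by apply/subsetP => w; rewrite !unfold_in => /andP[].
- by rewrite divr_ge0 ?ltW ?ler0n.
- by have := eps_le_degree; lra.
exact: many_conflicts.
Qed.

End Bipartite.

(** * Choice of the sample size *)

Section SampleSize.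
Variable R : realType.
Implicit Types eps r : R.

Lemma truncnS_le (x : R) : 0 <= x -> (Num.truncn x).+1%:R <= x + 1.
Proof. by move=> x0; rewrite -natr1 lerD2r truncn_le. Qed.

(** The 24 makes [4 / eps * expR (- logsize eps)] equal to 1/6. *)
Definition logsize eps : R := ln (24 / eps).

(** The test does not know the edge density, so the first summand allows for the sparsest case
    [r = eps^-1]; in denser cases the surplus draws join the second phase. *)
Definition sample_size eps : nat :=
  ((Num.truncn (logsize eps / eps)).+1 +
   (Num.truncn (4 * (logsize eps + 8) / eps)).+1)%N.

Lemma logsize_ge0 eps : 0 < eps < 1 -> 0 <= logsize eps.
Proof. by move=> /andP[e0 e1]; rewrite ln_ge0 // ler_pdivlMr //; lra. Qed.

(* [r^-1] is the edge density of the Cayley graph; the left-hand side is the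
   bound of [avg_two_colorable]. *)
Lemma sample_size_split eps r : 0 < eps < 1 -> 1 <= r <= eps^-1 ->
  exists t s, sample_size eps = (t + s)%N /\
    4 / eps * (1 - r^-1) ^+ t +
    2 ^+ t * (expR r * (1 - eps * r / 4) ^+ s) <= 1 / 3.
Proof.
move=> e01 /andP[r1 re]; have [e0 e1] := andP e01.
have L0 := logsize_ge0 e01; set L := logsize eps in L0 *.
have r0 : 0 < r by lra.
have er : eps * r <= 1 by rewrite mulrC -ler_pdivlMr // div1r.
set t := (Num.truncn (L * r)).+1.
have tk : (t <= (Num.truncn (L / eps)).+1)%N.
  by rewrite ltnS le_truncn // ler_wpM2l.
exists t, (sample_size eps - t)%N; split.
  by rewrite subnKC // (leq_trans tk) // leq_addr.
set s := (_ - t)%N.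
have sL : 4 * (L + 8) / eps <= s%:R.
  apply: le_trans (ltW (truncnS_gt _)) _.
  by rewrite ler_nat /s leq_subRL ?leq_add2r // (leq_trans tk) // leq_addr.
have tL : L * r <= t%:R by apply/ltW/truncnS_gt.
have tU : t%:R <= L * r + 1.
  by rewrite truncnS_le // mulr_ge0 // ltW.
clearbody s; clear tk; clearbody t.
have first : 4 / eps * (1 - r^-1) ^+ t <= 1 / 6.
  apply: (@le_trans _ _ (4 / eps * expR (- L))).
    apply: ler_wpM2l; first by rewrite divr_ge0 ?ler0n ?ltW.
    apply: le_trans (expr1B_le_expR _ _) _; first by rewrite invf_le1.
    by rewrite ler_expR lerN2 ler_pdivlMr.
  rewrite expRN /L /logsize lnK ?posrE ?divr_gt0 ?ltr0n //.
  rewrite le_eqVlt; apply/orP; left; apply/eqP; field.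
  by rewrite gt_eqF.
clearbody L.
have second : 2 ^+ t * (expR r * (1 - eps * r / 4) ^+ s) <= 1 / 6.
  apply: (@le_trans _ _ (expR t%:R * (expR r * expR (- ((L + 8) * r))))).
    have e2 : 2 <= expR 1 :> R by have := expR_ge1Dx (1 : R); lra.
    have p1 : 2 ^+ t <= expR t%:R :> R.
      by rewrite -[t%:R]mulr1 expRM_natl lerXn2r ?nnegrE ?expR_ge0 ?ler0n.
    apply: ler_pM => //; first by rewrite exprn_ge0.
      by rewrite mulr_ge0 ?expR_ge0 // exprn_ge0 //; lra.
    rewrite ler_wpM2l ?expR_ge0 //.
    apply: le_trans (expr1B_le_expR _ _) _; first by lra.
    rewrite ler_expR lerN2.
    have -> : (L + 8) * r = 4 * (L + 8) / eps * (eps * r / 4).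
      by field; rewrite gt_eqF.
    by rewrite ler_wpM2r // divr_ge0 ?ler0n // mulr_ge0 // ltW.
  (* With [t <= L * r + 1] and [r >= 1] the exponent is at most [1 - 7 * r <= - 6]. *)
  rewrite -!expRD; apply: (@le_trans _ _ (expR (- 5))).
    by rewrite ler_expR; lra.
  rewrite expRN -div1r; apply: ler_wpM2l => //.
  rewrite lef_pV2 ?posrE ?expR_gt0 ?ltr0n //.
  by have := expR_ge1Dx (5 : R); lra.
by lra.
Qed.

(** The constant is 5 * 23 + 4 * 8 + 2, from ln 24 <= 23 and a cost of at most 1 <= 1/eps for each
    rounding. *)
Lemma sample_size_le eps : 0 < eps < 1 ->
  (sample_size eps)%:R <= 149 * (eps^-1 * (1 + ln eps^-1)).
Proof.
move=> e01; have [e0 e1] := andP e01.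
have L0 := logsize_ge0 e01.
have l0 : 0 <= ln eps^-1 by rewrite ln_ge0 // invf_ge1 // ltW.
have LE : logsize eps <= 23 + ln eps^-1.
  rewrite /logsize lnM ?posrE ?invr_gt0 ?ltr0n // lerD2r.
  by have := @le_ln1Dx R 23; rewrite (_ : 1 + 23 = 24); [apply|]; lra.
have i1 : 1 <= eps^-1 by rewrite invf_ge1 // ltW.
rewrite natrD.
have h1 : (Num.truncn (logsize eps / eps)).+1%:R <= logsize eps * eps^-1 + 1.
  by rewrite truncnS_le // divr_ge0 // ltW.
have h2 : (Num.truncn (4 * (logsize eps + 8) / eps)).+1%:R
    <= 4 * (logsize eps + 8) * eps^-1 + 1.
  by rewrite truncnS_le // divr_ge0 ?(ltW e0) //; lra.
have : logsize eps * eps^-1 <= (23 + ln eps^-1) * eps^-1.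
  by rewrite ler_wpM2r // invr_ge0 ltW.
have : 0 <= ln eps^-1 * eps^-1 by rewrite mulr_ge0 // invr_ge0 ltW.
by lra.
Qed.

End SampleSize.

(** * The edge-sampling test as sampling in a Cayley graph *)

Section EdgeTest.
Variables (R : realType) (n : nat).
Implicit Types f : boolfun n.

Definition cayley f : rel (F2vec n) := fun x y => f (x - y).

Lemma cayley_sym f : symmetric (cayley f).
Proof. by move=> x y; rewrite /cayley -[x - y]rV2_opp opprB. Qed.

(** Translation by [x] maps the neighbours of 0 onto those of [x]. *)
Lemma cayley_degree f x : #|cayley f x| = #|cayley f 0|.
Proof.
rewrite -[RHS](card_image (addIr x)); apply: eq_card => y; apply/idP/imageP.
  rewrite unfold_in => fxy; exists (y - x); rewrite ?subrK //.
  by rewrite unfold_in /cayley sub0r opprB.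
move=> [z]; rewrite unfold_in /cayley sub0r => fz ->.
by rewrite unfold_in opprD addrCA subrr addr0.
Qed.

(** Acceptance yields a functional equal to 1 on the queried support of [f]; its values separate the
    ends of every sampled edge. *)
Lemma edge_accepts_two_colorable k f (alpha : seed k n) :
  edge_accepts f alpha -> two_colorable (cayley f) (codom alpha).
Proof.
move=> /asboolP/ocf_on_functional[a Ha]; apply/asboolP.
exists (fun x => dot a x == 0); rewrite /codom /image_mem pairwise_map.
(* [pairwise] compares positions [i < j] only, exactly the pairs that are queried. *)
have : pairwise ltn (map val (enum 'I_k)).
  by rewrite val_enum_ord -(sorted_pairwise ltn_trans) iota_ltn_sorted.
rewrite pairwise_map; apply: sub_pairwise => i j /= ij; apply/implyP => fij.
have /Ha /(_ fij) : alpha i - alpha j \in edge_queries alpha.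
  by apply/imsetP; exists (i, j); rewrite ?inE.
rewrite rV2_opp dotD.
by case: (F2_cases (dot a (alpha i))) => ->;
   case: (F2_cases (dot a (alpha j))) => ->.
Qed.

Lemma edge_accepts_far (eps : R) f : 0 < eps < 1 -> eps_far eps f ->
  Pr R [pred alpha : seed (sample_size eps) n | edge_accepts f alpha] <= 1 / 3.
Proof.
move=> e01 far; have [e0 e1] := andP e01.
have V_gt0 : (0 < #|{: F2vec n}|)%N by apply/card_gt0P; exists 0.
have N_gt0 : 0 < #|{: F2vec n}|%:R :> R by rewrite ltr0n.
have farC s := cayley_violating_pairs s (fun a => eps_far_functional a far).
have dN := degree_le R V_gt0 (cayley_degree f).
have epsd := eps_le_degree V_gt0 (cayley_degree f) farC.
have d_gt0 : 0 < #|cayley f 0|%:R :> R.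
  by apply: lt_le_trans epsd; rewrite mulr_gt0.
set r : R := #|{: F2vec n}|%:R / #|cayley f 0|%:R.
have [||t [s [kE bound]]] := @sample_size_split R eps r _ _; first by [].
  rewrite ler_pdivlMr // mul1r dN /= ler_pdivrMr // mulrC ler_pdivlMr //.
  by rewrite mulrC.
apply: (le_trans (Pr_avg R V_gt0 (@edge_accepts_two_colorable _ f))).
rewrite kE; apply: le_trans bound.
have -> : eps * r / 4 = eps * #|{: F2vec n}|%:R / (4 * #|cayley f 0|%:R).
  by rewrite /r; field; rewrite gt_eqF.
rewrite invf_div; apply: avg_two_colorable => //.
- exact: cayley_sym.
- exact: cayley_degree.
Qed.

End EdgeTest.

(** * Query complexity, completeness and soundness of the test *)

Theorem theorem1p3 (R : realType) :
  exists k q : R -> nat,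
    [/\ soft_O k (fun eps => eps^-1),
        soft_O q (fun eps => eps ^- 2)
      & forall eps : R, 0 < eps < 1 -> forall n : nat,
          [/\ (query_complexity (k eps) n <= q eps)%N,
              forall f : boolfun n, OCF f ->
                Pr R [pred alpha : seed (k eps) n | edge_accepts f alpha] = 1
            & forall f : boolfun n, eps_far eps f ->
                2 / 3 <=
                Pr R [pred alpha : seed (k eps) n | ~~ edge_accepts f alpha]]].
Proof.
have seed_gt0 k n : 0 < #|{: seed k n}|%:R :> R.
  by rewrite ltr0n; apply/card_gt0P; exists [ffun=> 0].
exists (@sample_size R), (fun eps => (sample_size eps ^ 2)%N); split.
- by exists 149, 1%N => eps e01; rewrite expr1 sample_size_le.
- exists (149 ^+ 2), 2%N => eps e01; have [e0 e1] := andP e01.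
  have l0 : 0 <= ln eps^-1 by rewrite ln_ge0 // invf_ge1 // ltW.
  have i0 : 0 < eps^-1 by rewrite invr_gt0.
  (* Both sides are squares, so the bases are compared; the logarithm of [eps ^- 2] is twice that of
     [eps^-1], which only enlarges the bound. *)
  rewrite natrX -!exprVn lnXn // -!exprMn lerXn2r ?nnegrE ?ler0n //.
    by rewrite mulr_ge0 // mulr_ge0 ?ltW //; lra.
  apply: le_trans (sample_size_le e01) _.
  by do 2!(apply: ler_wpM2l; first by rewrite ?ltW); lra.
move=> eps e01 n; split.
- apply/bigmax_leqP => alpha _; apply: leq_trans (leq_imset_card _ _) _.
  by apply: leq_trans (max_card _) _; rewrite card_prod card_ord mulnn.
- move=> f ocff; rewrite /Pr (_ : #|_| = #|{: seed (sample_size eps) n}|).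
    by rewrite divff // gt_eqF.
  apply: eq_card => alpha; rewrite unfold_in /=; apply/asboolP.
  move=> m x om [_ fx sx]; apply: (ocff m x om); split=> // i.
  by rewrite inE.
move=> f far; have := edge_accepts_far e01 far.
set A := [pred alpha | edge_accepts f alpha].
rewrite (_ : Pr R [pred alpha | ~~ _ alpha] = 1 - Pr R A); first by lra.
rewrite /Pr; apply/eqP; rewrite eq_sym subr_eq -mulrDl -natrD addnC.
by rewrite (cardC A) divff // gt_eqF.
Qed.
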